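(* Let $X,Y,V,Z$ be real normed linear spaces, $C\subset X$ an open convex set, $F\colon C\to Y$ and $G\colon C\to V$ d.c. mappings, and $B\colon Y\times V\to Z$ a continuous bilinear mapping. Then the mapping $B\circ(F,G)\colon x\mapsto B\bigl(F(x),G(x)\bigr)$ is d.c. on $C$, provided at least one of the following conditions is satisfied: (a) both $Y$ and $V$ admit equivalent norms with modulus of convexity of power type 2; (b) $Z$ is finite-dimensional and $Y\times V$ has the property (D).
   Context: Let $X,Y$ be real normed linear spaces and $C\subset X$ convex. A continuous mapping $F\colon C\to Y$ is called d.c. (delta-convex) if there is a continuous function $f\colon C\to\mathbb{R}$ (a control function of $F$) such that $y^*\circ F+f$ is convex on $C$ for every $y^*\in Y^*$ with $\|y^*\|\le 1$. A normed linear space $X$ has modulus of convexity of power type 2 if there is $a>0$ with $\delta_X(\varepsilon)\ge a\varepsilon^2$ for each $\varepsilon\in(0,2]$, where $\delta_X(\varepsilon)=\inf\{1-\|\tfrac{x+y}{2}\|:\|x\|\le1,\|y\|\le1,\|x-y\|\ge\varepsilon\}$ is the classical modulus of convexity. A mapping $Q\colon X\to Y$ between vector spaces is quadratic if there is a bilinear mapping $b\colon X\times X\to Y$ with $Q(x)=b(x,x)$ for all $x\in X$; a quadratic form is a quadratic mapping into $\mathbb{R}$. A normed linear space $X$ has the property (D) if every continuous quadratic form on $X$ is the difference of two nonnegative continuous quadratic forms on $X$. The product $Y\times V$ carries any of the usual (equivalent) product norms. *)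

(* Defs.v *)
From HB Require Import structures.
From mathcomp Require Import all_boot all_order all_algebra.
From mathcomp Require Import all_classical all_reals all_analysis.

Set Implicit Arguments.
Unset Strict Implicit.
Unset Printing Implicit Defensive.

Import Order.TTheory GRing.Theory Num.Theory.
Import numFieldNormedType.Exports.

Local Open Scope classical_set_scope.
Local Open Scope ring_scope.

(* Operator norm of a linear functional. As [sup] is 0 on unbounded sets, it
   is meaningful only for continuous functionals. *)
Definition dual_norm (R : realType) (Y : normedModType R)
    (phi : {linear Y -> R^o}) : R :=
  sup [set `|phi y| | y in [set y : Y | `|y| <= 1]].

(* Mappings on [C] are represented by total functions whose values outside [C]
   are irrelevant, whence the relative continuity [{within C, _}]. *)
Definition control_function (R : realType) (X Y : normedModType R)
    (C : set X) (F : X -> Y) (f : X -> R^o) : Prop :=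
  {within C, continuous f} /\
  forall phi : {linear Y -> R^o}, continuous phi -> dual_norm phi <= 1 ->
    convex_function C (fun x => phi (F x) + f x).

Definition dc_mapping (R : realType) (X Y : normedModType R)
    (C : set X) (F : X -> Y) : Prop :=
  {within C, continuous F} /\ exists f : X -> R^o, control_function C F f.

Definition is_norm (R : realType) (X : lmodType R) (N : X -> R) : Prop :=
  [/\ forall x, 0 <= N x,
      forall x, N x = 0 -> x = 0,
      forall (a : R) x, N (a *: x) = `|a| * N x
    & forall x y, N (x + y) <= N x + N y].

Definition equivalent_norm (R : realType) (X : normedModType R)
    (N : X -> R) : Prop :=
  is_norm N /\
  exists c d : R, [/\ 0 < c, 0 < d & forall x, c * `|x| <= N x <= d * `|x|].

(* Extended-real valued, so that the infimum of the empty set (which occurs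
   only for the null space when 0 < eps <= 2) is +oo. *)
Definition modulus_of_convexity (R : realType) (X : lmodType R) (N : X -> R)
    (eps : R) : \bar R :=
  ereal_inf [set (1 - N (2^-1 *: (p.1 + p.2)))%:E | p in
    [set p : X * X | [/\ N p.1 <= 1, N p.2 <= 1 & eps <= N (p.1 - p.2)]]].

Definition convexity_power_type2 (R : realType) (X : lmodType R)
    (N : X -> R) : Prop :=
  exists2 a : R, 0 < a &
    forall eps : R, 0 < eps <= 2 ->
      ((a * eps ^+ 2)%:E <= modulus_of_convexity N eps)%E.

Definition admits_power_type2_norm (R : realType) (X : normedModType R)
    : Prop :=
  exists2 N : X -> R, equivalent_norm N & convexity_power_type2 N.

Definition quadratic (R : realType) (X Y : lmodType R) (Q : X -> Y) : Prop :=
  exists b : {bilinear X -> X -> Y}, forall x, Q x = b x x.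

Definition property_D (R : realType) (X : normedModType R) : Prop :=
  forall Q : X -> R^o, quadratic Q -> continuous Q ->
    exists Q1 Q2 : X -> R^o,
      [/\ quadratic Q1 /\ quadratic Q2,
          continuous Q1 /\ continuous Q2,
          forall x, 0 <= Q1 x,
          forall x, 0 <= Q2 x
        & forall x, Q x = Q1 x - Q2 x].

Definition finite_dimensional (R : realType) (Z : lmodType R) : Prop :=
  exists n : nat, inhabited (Vector.axiom n Z).

(* Main.v *)
Require Import Defs.
From HB Require Import structures.
From mathcomp Require Import all_boot all_order all_algebra.
From mathcomp Require Import all_classical all_reals all_analysis.
From mathcomp Require Import ring lra.

Set Implicit Arguments.
Unset Strict Implicit.
Unset Printing Implicit Defensive.

Import Order.TTheory GRing.Theory Num.Theory.
Import numFieldNormedType.Exports.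

Local Open Scope classical_set_scope.
Local Open Scope ring_scope.

(* Write [midgap F x y = F x + F y - 2 F ((x + y) / 2)]. By Hahn-Banach, [f]
   controls [F] iff [|midgap F| <= midgap f], and a control [k] of
   [H = (F, G)] may be taken nonnegative. With [m'] the midpoint of [H x] and
   [H y], and [m] the midpoint of [x] and [y], a quadratic [q] gives
     [midgap (q o H) x y = midgap q (H x) (H y) + 2 (q m' - q (H m))].
   The last difference is O(|m' - H m| (|m'| + |H m|)), which is dominated by
   the midpoint gap of [(|H| + 2 k)^2]. Since [midgap q a b = q (a - b) / 2], it
   remains to find [P] with [|B w| / 2 <= midgap P a b] for [w = a - b]: a
   combination of squares of 2-uniformly convex norms in case (a), and a
   combination of the nonnegative forms given by property (D), applied to the
   coordinates of [B], in case (b). *)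

(** * Sublinear functionals and the Hahn-Banach theorem *)

Definition sublinear (R : realType) (E : lmodType R) (p : E -> R) : Prop :=
  [/\ p 0 = 0, forall x y, p (x + y) <= p x + p y
    & forall (t : R) x, 0 < t -> p (t *: x) <= t * p x].

Lemma sublinearN (R : realType) (E : lmodType R) (p : E -> R) (x : E) :
  sublinear p -> - p (- x) <= p x.
Proof.
by move=> [p0 pD _]; have := pD x (- x); rewrite subrr p0 => h; lra.
Qed.

(** The reverse of the assumed inequality is that same inequality for the factor [t^-1] at the point
    [t *: x]. *)
Lemma sublinearZ (R : realType) (E : lmodType R) (p : E -> R) (t : R) (x : E) :
  sublinear p -> 0 <= t -> p (t *: x) = t * p x.
Proof.
move=> [p0 _ pZ]; rewrite le_eqVlt => /predU1P[<-|t0].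
  by rewrite scale0r p0 mul0r.
apply/eqP; rewrite eq_le pZ//=.
have := pZ t^-1 (t *: x); rewrite invr_gt0 scalerA mulVf ?gt_eqF// scale1r.
by move=> /(_ t0); rewrite ler_pdivlMl.
Qed.

(** Serves both for the tilts of one functional and for chains in Zorn's lemma. The minorant [l]
    makes the infima genuine; subadditivity and homogeneity pass to the infimum because each is
    witnessed by some member of [G]. *)
Lemma inf_sublinear (R : realType) (E : lmodType R) (G : set (E -> R))
    (l : E -> R) :
  G !=set0 -> (forall g x, G g -> l x <= g x) -> (forall g, G g -> g 0 = 0) ->
  (forall g h x y, G g -> G h -> exists2 k, G k & k (x + y) <= g x + h y) ->
  (forall g (t : R) x, G g -> 0 < t -> exists2 k, G k & k (t *: x) <= t * g x) ->
  sublinear (fun x => inf [set g x | g in G]) /\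
  forall g x, G g -> inf [set g x | g in G] <= g x.
Proof.
move=> [g0 Gg0] lG G0 GD GZ.
have lb x : has_lbound [set g x | g in G].
  by exists (l x) => _ [g Gg <-]; exact: lG.
have infle g x : G g -> inf [set g x | g in G] <= g x.
  by move=> Gg; apply: ge_inf => //; exists g.
have leinf (r : R) x : (forall g, G g -> r <= g x) -> r <= inf [set g x | g in G].
  move=> h; apply: lb_le_inf; first by exists (g0 x), g0.
  by move=> _ [g Gg <-]; exact: h.
split=> //; split.
- rewrite (_ : [set _ | _ in _] = [set 0]) ?inf1//.
  apply/seteqP; split => [_ [g Gg <-]|_ ->] /=; first exact: G0.
  by exists g0 => //; exact: G0.
- move=> x y; rewrite -lerBlDr; apply: (leinf _ x) => g Gg.
  rewrite lerBlDr -lerBlDl; apply: (leinf _ y) => h Gh; rewrite lerBlDl.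
  have [k Gk] := GD _ _ x y Gg Gh.
  exact/le_trans/infle.
- move=> t x t0; rewrite -ler_pdivrMl//; apply: (leinf _ x) => g Gg.
  rewrite ler_pdivrMl//.
  have [k Gk] := GZ _ _ x Gg t0.
  exact/le_trans/infle.
Qed.

(* A sublinear functional minimal for the pointwise order coincides with all its
   tilts [q], which forces it to be additive. *)
Lemma sublinear_tilt (R : realType) (E : lmodType R) (p : E -> R) (y : E) :
  sublinear p -> exists q : E -> R,
    [/\ sublinear q, forall x, q x <= p x
      & forall x, q x <= p (x + y) - p y].
Proof.
move=> sp; have [p0 pD pZ] := sp.
(* The tilt is the infimum of [g t] over t >= 0: t = 0 gives the bound by [p], and t = 1 the bound
   by p (x + y) - p y. It is finite because p (t y) <= p (x + t y) + p (- x). *)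
pose g (t : R) x := p (x + t *: y) - t * p y.
have [] := @inf_sublinear _ _ [set g t | t in [set t | 0 <= t]] (fun x => - p (- x)).
- by exists (g 0), 0 => /=.
- move=> _ x [t /= t0 <-]; rewrite /g -sublinearZ//.
  by have := pD (x + t *: y) (- x); rewrite addrAC subrr add0r => h; lra.
- by move=> _ [t /= t0 <-]; rewrite /g add0r sublinearZ// subrr.
- move=> _ _ x z [t /= t0 <-] [s /= s0 <-]; exists (g (t + s)).
    by exists (t + s) => //=; rewrite addr_ge0.
  rewrite /g scalerDl addrACA; have := pD (x + t *: y) (z + s *: y) => h; lra.
- move=> _ s x [t /= t0 <-] s0; exists (g (s * t)).
    by exists (s * t) => //=; rewrite mulr_ge0// ltW.
  rewrite /g -scalerA -scalerDr; have := pZ s (x + t *: y) s0 => h; lra.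
- move=> sq qg; eexists; split; first exact: sq.
    move=> x; have /(qg _ x) : [set g t | t in [set t | 0 <= t]] (g 0).
      by exists 0 => /=.
    by rewrite {2}/g scale0r addr0 mul0r subr0.
  move=> x; have /(qg _ x) : [set g t | t in [set t | 0 <= t]] (g 1).
    by exists 1 => /=.
  by rewrite {2}/g scale1r mul1r.
Qed.

Lemma minimal_sublinear (R : realType) (E : lmodType R) (p : E -> R) :
  sublinear p -> exists q : E -> R,
    [/\ sublinear q, forall x, q x <= p x
      & forall r, sublinear r -> (forall x, r x <= q x) -> r = q].
Proof.
move=> sp; pose T := {q : E -> R | sublinear q /\ forall x, q x <= p x}.
(* The order is reversed, so that a maximal element for Zorn is a minimal functional; a chain is
   then bounded by its pointwise infimum. *)
pose le_ (q r : T) := `[< forall x, sval r x <= sval q x >].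
have [| | |A totA|[q [sq qp]] qmax] := @Zorn T le_.
- by move=> t; apply/asboolP.
- move=> r s t /asboolP rs /asboolP st; apply/asboolP => x.
  exact: le_trans (st x) (rs x).
- move=> [s Ps] [t Pt] /asboolP /= st /asboolP /= ts.
  by apply: eq_exist; apply/funext => x; apply/eqP; rewrite eq_le st ts.
- have [[q0 Aq0]|A0] := pselect (A !=set0); last first.
    by exists (exist _ p (conj sp (fun x => lexx (p x)))) => s As; case: A0; exists s.
  have [] := @inf_sublinear _ _ [set sval q | q in A] (fun x => - p (- x)).
  + by exists (sval q0), q0.
  + move=> _ x [[q [sq qp]] _ <-] /=; apply: le_trans (sublinearN x sq).
    by rewrite lerN2.
  + by move=> _ [[q [[]]]] ? ? ? ? ? <-.
  (* Of two members of a chain, the smaller one is subadditive and lies below both. *)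
  + move=> _ _ x y [q Aq <-] [r Ar <-].
    have [/asboolP qr|/asboolP rq] := totA _ _ Aq Ar.
      exists (sval r); first by exists r.
      have [[_ rD _] _] := svalP r.
      by rewrite (le_trans (rD _ _))// lerD2r.
    exists (sval q); first by exists q.
    have [[_ qD _] _] := svalP q.
    by rewrite (le_trans (qD _ _))// lerD2l.
  + move=> _ t x [q Aq <-] t0; exists (sval q); first by exists q.
    by have [[_ _ qZ] _] := svalP q; exact: qZ.
  move=> sq qA; set q := (fun x => _) in sq.
  have qp x : q x <= p x.
    have [_ q0p] := svalP q0; apply: le_trans (q0p x).
    by apply: qA; exists q0.
  exists (exist _ q (conj sq qp)) => s As; apply/asboolP => x /=.
  by apply: qA; exists s.
exists q; split=> // r sr rq.
have rp x : r x <= p x := le_trans (rq x) (qp x).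
have := qmax (exist _ r (conj sr rp)).
by move/(_ (asboolT rq)) => [].
Qed.

Lemma hahn_banach (R : realType) (E : lmodType R) (p : E -> R) (y : E) :
  sublinear p -> exists phi : {linear E -> R^o},
    (forall x, phi x <= p x) /\ phi y = p y.
Proof.
move=> sp; have [p0 _ _] := sp.
(* Tilting along [y] before minimising forces q (- y) <= p 0 - p y = - p y, hence q y >= p y once
   [q] is linear. *)
have [py [spy pyp pyy]] := sublinear_tilt y sp.
have [q [sq qpy qmin]] := minimal_sublinear spy.
have [q0 qD _] := sq.
have qp x : q x <= p x := le_trans (qpy x) (pyp x).
(* By minimality [q] equals its tilt along [z], so q x <= q (x + z) - q z, which is
   superadditivity. *)
have qadd x z : q (x + z) = q x + q z.
  have [r [sr rq rz]] := sublinear_tilt z sq.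
  have rqE := qmin r sr rq.
  apply/eqP; rewrite eq_le qD/= -lerBrDr.
  by have := rz x; rewrite rqE.
have qN x : q (- x) = - q x.
  by apply/eqP; rewrite -addr_eq0 -qadd addNr q0.
have qlin : linear (q : E -> R^o).
  move=> a x z; rewrite qadd; congr (_ + _).
  have [a0|a0] := leP 0 a; first exact: sublinearZ.
  rewrite -[X in q (X *: x)]opprK scaleNr qN sublinearZ ?oppr_ge0 ?ltW//.
  by rewrite mulNr opprK.
pose m := GRing.isLinear.Build R E R^o _ (q : E -> R^o) qlin.
pose phi : {linear E -> R^o} := HB.pack (q : E -> R^o) m.
exists phi; split=> [x|]; first exact: qp.
apply/eqP; rewrite eq_le [_ <= _]qp/=.
have := le_trans (qpy (- y)) (pyy (- y)).
by rewrite addNr p0 qN sub0r lerN2.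
Qed.

Lemma norming_functional (R : realType) (Y : normedModType R) (y : Y) :
  exists phi : {linear Y -> R^o},
    [/\ continuous phi, dual_norm phi <= 1 & phi y = `|y|].
Proof.
have [] := @hahn_banach _ _ (fun x => `|x|) y.
  split=> [|x z|t x t0].
  - exact: normr0.
  - exact: ler_normD.
  - by rewrite normrZ gtr0_norm.
move=> phi [phile phiy]; exists phi.
have phin x : `|phi x| <= `|x|.
  rewrite ler_norml phile andbT lerNl -linearN -(normrN x).
  exact: phile.
split=> //.
- apply/linear_bounded_continuous/linear_boundedP; near=> r => x.
  by rewrite (le_trans (phin x))// ler_peMl//; near: r; exact: nbhs_pinfty_ge.
- apply: ge_sup; first by exists `|phi 0|, 0 => //=; rewrite normr0.
  by move=> _ [x /= x1 <-]; exact: le_trans (phin x) x1.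
Unshelve. all: by end_near. Qed.

(** Continuity bounds the set under [sup], so that [sup] is an upper bound of it; this is applied to
    the normalised vector. *)
Lemma dual_norm_le1 (R : realType) (Y : normedModType R)
    (phi : {linear Y -> R^o}) (y : Y) :
  continuous phi -> dual_norm phi <= 1 -> `|phi y| <= `|y|.
Proof.
move=> /linear_bounded_continuous/linear_boundedP/pinfty_ex_gt0[r r0 phir] phi1.
have [->|y0] := eqVneq y 0; first by rewrite linear0 !normr0.
have yn0 : 0 < `|y| by rewrite normr_gt0.
have : `|phi (`|y|^-1 *: y)| <= 1.
  apply: le_trans phi1; apply: ub_le_sup.
    exists r => _ [x /= x1 <-]; rewrite (le_trans (phir x))//.
    by rewrite ler_piMr// ltW.
  exists (`|y|^-1 *: y) => //=.
  by rewrite normrZ gtr0_norm ?invr_gt0// mulVf ?gt_eqF.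
by rewrite linearZ/= normrZ gtr0_norm ?invr_gt0// ler_pdivrMl// mulr1.
Qed.

(** * Midpoint gaps and controls of d.c. mappings *)

Definition midgap (R : realType) (X W : lmodType R) (F : X -> W) (x y : X) : W :=
  F x + F y - 2 *: F (2^-1 *: (x + y)).

Lemma midgapE (R : realType) (X : lmodType R) (f : X -> R) (x y : X) :
  midgap (f : X -> R^o) x y = f x + f y - 2 * f (2^-1 *: (x + y)).
Proof. by []. Qed.

Lemma linear_midgap (R : realType) (X W : lmodType R) (phi : {linear W -> R^o})
    (F : X -> W) (x y : X) :
  phi (midgap F x y) = phi (F x) + phi (F y) - 2 * phi (F (2^-1 *: (x + y))).
Proof.
by rewrite /midgap; move: (F (2^-1 *: _)) => w; rewrite linearB linearD linearZ.
Qed.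

Lemma convex_setP (R : realType) (X : lmodType R) (C : set X) (x y : X) (t : R) :
  convex_set C -> 0 <= t <= 1 -> C x -> C y -> C (t *: x + (1 - t) *: y).
Proof.
move=> cC /andP[t0 t1] Cx Cy.
have := cC x y (Itv01 t0 t1); rewrite !inE; exact.
Qed.

Lemma convex_set_mid (R : realType) (X : lmodType R) (C : set X) (x y : X) :
  convex_set C -> C x -> C y -> C (2^-1 *: (x + y)).
Proof.
move=> cC Cx Cy.
have -> : 2^-1 *: (x + y) = 2^-1 *: x + (1 - 2^-1) *: y.
  by rewrite scalerDr; congr (_ + _ *: _); lra.
by apply: convex_setP => //; lra.
Qed.

(** On the segment, [h] is [f] minus its chord: it is midpoint convex and vanishes at both ends. A
    maximum point c is the midpoint of 0 and 2c, or of 2c - 1 and 1, so h c <= h c / 2 and the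
    maximum is at most 0. *)
Lemma midpoint_convex_continuous (R : realType) (X : normedModType R)
    (C : set X) (f : X -> R) (x y : X) (t : R) :
  convex_set C -> {in C, continuous f} ->
  (forall x y, C x -> C y -> 0 <= midgap (f : X -> R^o) x y) ->
  C x -> C y -> 0 <= t <= 1 -> f (t *: x + (1 - t) *: y) <= t * f x + (1 - t) * f y.
Proof.
move=> cC fc fmid Cx Cy t01.
pose z (s : R) := s *: x + (1 - s) *: y.
pose h (s : R) := f (z s) - (s * f x + (1 - s) * f y).
have zc s : {for s, continuous z}.
  apply: cvgD; apply: cvgZr_tmp; first exact: cvg_id.
  by apply: cvgB; [exact: cvg_cst|exact: cvg_id].
have Cz s : 0 <= s <= 1 -> C (z s) by move=> s01; exact: convex_setP.
have hc : {within `[0, 1], continuous h}.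
  apply: continuous_in_subspaceT => s; rewrite inE/= in_itv/= => s01.
  apply: cvgB.
    by apply: continuous_comp; [exact: zc|apply: fc; rewrite inE; exact: Cz].
  apply: cvgD; apply: cvgM; try exact: cvg_cst.
    exact: cvg_id.
  by apply: cvgB; [exact: cvg_cst|exact: cvg_id].
have hmid s r : 0 <= s <= 1 -> 0 <= r <= 1 -> h ((s + r) / 2) <= (h s + h r) / 2.
  move=> s01 r01; have := fmid _ _ (Cz _ s01) (Cz _ r01).
  rewrite midgapE.
  have -> : 2^-1 *: (z s + z r) = z ((s + r) / 2).
    rewrite /z addrACA -!scalerDl scalerDr !scalerA; congr (_ *: _ + _ *: _); lra.
  rewrite /h => g; lra.
have [c] := EVT_max ler01 hc; rewrite in_itv/= => c01 hmax.
have h0 : h 0 = 0 by rewrite /h /z scale0r add0r subr0 scale1r; ring.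
have h1 : h 1 = 0 by rewrite /h /z subrr scale0r scale1r addr0; ring.
have hc0 : h c <= 0.
  have [c2|c2] := leP c 2^-1.
    have c201 : 0 <= 2 * c <= 1 by lra.
    have := hmid _ _ (_ : 0 <= 0 <= 1) c201; rewrite h0 add0r mulrAC divff ?mul1r//.
    have := hmax (2 * c); rewrite in_itv/= c201 => /(_ isT) ? /(_ _); lra.
  have c201 : 0 <= 2 * c - 1 <= 1 by lra.
  have := hmid 1 _ (_ : 0 <= 1 <= 1) c201; rewrite h1 addrC subrK mulrAC divff ?mul1r//.
  have := hmax (2 * c - 1); rewrite in_itv/= c201 => /(_ isT) ? /(_ _); lra.
have := hmax t; rewrite in_itv/= t01 => /(_ isT); rewrite /h /z => ht.
by move: hc0 ht; rewrite /h /z; lra.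
Qed.

Lemma control_function_midgap (R : realType) (X Y : normedModType R)
    (C : set X) (F : X -> Y) (f : X -> R^o) (x y : X) :
  control_function C F f -> C x -> C y -> `|midgap F x y| <= midgap f x y.
Proof.
move=> [_ Fconv] Cx Cy.
(* Convexity at 1/2 reads 0 <= phi (midgap F) + midgap f, whence a functional norming the opposite
   of the gap. *)
have [phi [phic phi1 phiE]] := norming_functional (- midgap F x y).
have h0 : 0 <= 2^-1 :> R by lra.
have h1 : 2^-1 <= 1 :> R by lra.
have := Fconv phi phic phi1 (Itv01 h0 h1) x y; rewrite !inE => /(_ Cx Cy).
have -> : conv (Itv01 h0 h1) (x : convex_lmodType X) y = 2^-1 *: (x + y).
  have e : 1 - 2^-1 = 2^-1 :> R by lra.
  transitivity (2^-1 *: x + (1 - 2^-1) *: y); first by [].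
  by rewrite e scalerDr.
move=> h.
have {}h : phi (F (2^-1 *: (x + y))) + f (2^-1 *: (x + y)) <=
    2^-1 * (phi (F x) + f x) + (1 - 2^-1) * (phi (F y) + f y) by exact: h.
by rewrite -normrN -phiE linearN linear_midgap midgapE; lra.
Qed.

(** The gap of phi o F is at most |midgap F| in absolute value, so phi o F + f is midpoint convex,
    and continuity makes it convex. *)
Lemma midgap_control_function (R : realType) (X Y : normedModType R)
    (C : set X) (F : X -> Y) (f : X -> R^o) :
  open C -> convex_set C -> {in C, continuous F} -> {in C, continuous f} ->
  (forall x y, C x -> C y -> `|midgap F x y| <= midgap f x y) ->
  control_function C F f.
Proof.
move=> oC cC Fc fc Ff; split; first by rewrite continuous_open_subspace.
move=> phi phic phi1 t x y; rewrite !inE => Cx Cy.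
have t01 : 0 <= t%:num <= 1 by apply/andP; split.
apply: (@midpoint_convex_continuous R X C (fun x => phi (F x) + f x)) => //.
  move=> z zC; apply: cvgD; last exact: fc.
  by apply: (@continuous_comp _ _ _ F phi); [exact: Fc|exact: phic].
move=> {Cx Cy}x {}y Cx Cy.
have := le_trans (dual_norm_le1 (midgap F x y) phic phi1) (Ff x y Cx Cy).
rewrite ler_norml (linear_midgap phi) (midgapE f).
by rewrite (midgapE (fun x => phi (F x) + f x)) => /andP[? _]; lra.
Qed.

Lemma dc_mappingP (R : realType) (X Y : normedModType R)
    (C : set X) (F : X -> Y) :
  open C -> convex_set C ->
  dc_mapping C F <->
  {in C, continuous F} /\ exists2 f : X -> R^o, {in C, continuous f} &
    forall x y, C x -> C y -> `|midgap F x y| <= midgap f x y.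
Proof.
move=> oC cC; rewrite /dc_mapping continuous_open_subspace//.
split=> [[Fc [f Ff]]|[Fc [f fc Ff]]]; split => //; exists f.
- by move: Ff => [+ _]; rewrite continuous_open_subspace.
- by move=> x y; exact: control_function_midgap.
- exact: midgap_control_function.
Qed.

Lemma midgapD (R : realType) (X W : lmodType R) (F G : X -> W) (x y : X) :
  midgap (fun x => F x + G x) x y = midgap F x y + midgap G x y.
Proof. by rewrite /midgap scalerDr opprD (addrACA (F x)) [LHS]addrACA. Qed.

Lemma midgapZ (R : realType) (X : lmodType R) (c : R) (f : X -> R) (x y : X) :
  midgap ((fun x => c * f x) : X -> R^o) x y = c * midgap (f : X -> R^o) x y.
Proof. by rewrite !midgapE; lra. Qed.

(* A convex function bounded on a ball around [x0] is bounded below by a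
   multiple of [- `|x - x0|]. *)
Lemma nonneg_control (R : realType) (X Y : normedModType R)
    (C : set X) (F : X -> Y) (f : X -> R^o) :
  open C -> convex_set C -> {in C, continuous f} ->
  (forall x y, C x -> C y -> `|midgap F x y| <= midgap f x y) ->
  exists k : X -> R^o, [/\ {in C, continuous k},
    forall x, C x -> 0 <= k x
    & forall x y, C x -> C y -> `|midgap F x y| <= midgap k x y].
Proof.
move=> oC cC fc Ff.
have [[x0 Cx0]|C0] := pselect (C !=set0); last first.
  by exists f; split => // x Cx; case: C0; exists x.
have fx0 : {for x0, continuous f} by apply: fc; rewrite inE.
have [r r0 rC] : exists2 r : R, 0 < r & forall z, `|x0 - z| <= r ->
    C z /\ f x0 - f z <= 1.
  have : \forall z \near x0, C z /\ `|f x0 - f z| <= 1.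
    near=> z; split; near: z; first exact: open_nbhs_nbhs.
    exact: cvgr_dist_le.
  move=> /nbhs_ballP[e /= e0 he]; exists (e / 2); first by lra.
  move=> z zr; have [|Cz fz] := he z; last first.
    by split => //; move: fz; rewrite ler_norml; lra.
  by rewrite -ball_normE /=; lra.
have fge x : C x -> f x0 - 1 - r^-1 * `|x - x0| <= f x.
  move=> Cx; have [xr|xr] := leP `|x0 - x| r.
    have [_] := rC _ xr; have : 0 <= r^-1 * `|x - x0| by rewrite mulr_ge0// invr_ge0 ltW.
    by lra.
  have n0 : 0 < `|x0 - x| := lt_trans r0 xr.
  (* This [s] puts s x + (1 - s) x0 on the sphere of radius [r] around [x0], where [f] is at least f
     x0 - 1; convexity along the segment carries the bound out to [x]. *)
  pose s := r / `|x0 - x|.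
  have s0 : 0 < s by rewrite divr_gt0.
  have s1 : s < 1 by rewrite ltr_pdivrMr// mul1r.
  have sE : s * (r^-1 * `|x - x0|) = 1.
    by rewrite distrC /s; field; rewrite gt_eqF//= gt_eqF.
  have [|_ fz] := rC (s *: x + (1 - s) *: x0).
    rewrite (_ : x0 - _ = s *: (x0 - x)); last first.
      by rewrite scalerBl scale1r [s *: x + _]addrCA opprD addrA subrr sub0r opprB -scalerBr.
    by rewrite normrZ gtr0_norm// /s divfK// gt_eqF.
  have := @midpoint_convex_continuous R X C f x x0 s cC fc _ Cx Cx0.
  have fm x' y' : C x' -> C y' -> 0 <= midgap f x' y'.
    by move=> ? ?; exact: le_trans (Ff _ _ _ _).
  have s01 : 0 <= s <= 1 by rewrite !ltW.
  move=> /(_ fm s01) fconv.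
  rewrite -(ler_pM2l s0); nra.
(* The added function is convex, so it cannot decrease the midpoint gap, and [fge] makes the sum
   nonnegative. *)
exists (fun x => f x + (r^-1 * `|x - x0| + (1 - f x0))); split.
- move=> z zC; apply: cvgD; first exact: fc.
  apply: cvgD; last exact: cvg_cst.
  apply: cvgM; first exact: cvg_cst.
  by apply: cvg_norm; apply: cvgB; [exact: cvg_id|exact: cvg_cst].
- by move=> x /fge; lra.
move=> x y Cx Cy; apply: le_trans (Ff _ _ Cx Cy) _; rewrite !midgapE.
have := ler_normD (x - x0) (y - x0).
have -> : x - x0 + (y - x0) = 2 *: (2^-1 *: (x + y) - x0).
  by rewrite scalerBr scalerA divff// scale1r scalerDl scale1r addrACA opprD.
rewrite normrZ normr_nat => h; have : 0 < r^-1 by rewrite invr_gt0.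
by move=> ri; have := ler_wpM2l (ltW ri) h; lra.
Unshelve. all: by end_near. Qed.

(** * Quadratic Lipschitz estimates, pairs and compositions *)

Definition quad_lipschitz (R : realType) (W Z : normedModType R) (q : W -> Z)
    : Prop :=
  exists2 K : R, 0 <= K &
    forall u v, `|q u - q v| <= K * (`|u - v| * (`|u| + `|v|)).

Lemma quad_lipschitz_continuous (R : realType) (W Z : normedModType R)
    (q : W -> Z) :
  quad_lipschitz q -> continuous q.
Proof.
move=> [K K0 qK] u; apply/cvgrPdist_le => e e0.
pose M := K * (2 * `|u| + 1) + 1.
have M0 : 0 < M by rewrite ltr_wpDl// mulr_ge0// addr_ge0// mulr_ge0.
near=> v.
have uv1 : `|u - v| <= 1.
  by near: v; apply: cvgr_dist_le; [exact: cvg_id|exact: ltr01].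
have uve : `|u - v| <= e / M.
  by near: v; apply: cvgr_dist_le; [exact: cvg_id|exact: divr_gt0].
apply: le_trans (qK u v) _.
have vu : `|v| <= `|u| + 1.
  have := ler_normD (v - u) u; rewrite subrK distrC; lra.
apply: (@le_trans _ _ (`|u - v| * M)); last by rewrite -ler_pdivlMr.
rewrite mulrCA ler_wpM2l// /M.
apply: (@le_trans _ _ (K * (2 * `|u| + 1))); last by lra.
by rewrite ler_wpM2l//; lra.
Unshelve. all: by end_near. Qed.

Lemma dc_mapping_pair (R : realType) (X Y V : normedModType R)
    (C : set X) (F : X -> Y) (G : X -> V) :
  open C -> convex_set C -> dc_mapping C F -> dc_mapping C G ->
  dc_mapping C (fun x => (F x, G x)).
Proof.
move=> oC cC /(dc_mappingP _ oC cC)[Fc [f fc Ff]].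
move=> /(dc_mappingP _ oC cC)[Gc [g gc Gg]].
apply/dc_mappingP => //; split.
  by move=> x xC; apply: cvg_pair; [exact: Fc|exact: Gc].
exists (fun x => f x + g x).
  by move=> x xC; apply: cvgD; [exact: fc|exact: gc].
move=> x y Cx Cy; rewrite (midgapD f g) prod_normE ge_max.
have Fxy := Ff x y Cx Cy; have Gxy := Gg x y Cx Cy.
apply/andP; split.
  apply: le_trans (Fxy : `|midgap F x y| <= _) _.
  by rewrite lerDl (le_trans _ Gxy).
apply: le_trans (Gxy : `|midgap G x y| <= _) _.
by rewrite lerDr (le_trans _ Fxy).
Qed.

(** With A = (g x + g y) / 2 and m the midpoint, the gap of g^2 equals (g x - g y)^2 / 2 + midgap g
    * (A + g m). *)
Lemma midgap_sqr_ge (R : realType) (X : lmodType R) (g : X -> R) (x y : X) (d s : R) :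
  0 <= d -> 0 <= s -> d <= midgap (g : X -> R^o) x y ->
  s <= (g x + g y) / 2 + g (2^-1 *: (x + y)) ->
  d * s <= midgap ((fun x => g x ^+ 2) : X -> R^o) x y.
Proof.
rewrite !midgapE => d0 s0 dg sg; have := ler_pM d0 s0 dg sg.
have := sqr_ge0 (g x - g y); nra.
Qed.

(** The estimate asked of [q] and [P] is shared by continuous quadratic mappings and by squares of
    equivalent norms, so that both cases of the theorem pass through this lemma. *)
Lemma dc_mapping_comp (R : realType) (X W Z : normedModType R)
    (C : set X) (H : X -> W) (q : W -> Z) (P : W -> R^o) :
  open C -> convex_set C -> dc_mapping C H ->
  quad_lipschitz q -> quad_lipschitz P ->
  (forall a b, `|midgap q a b| <= midgap P a b) ->
  dc_mapping C (fun x => q (H x)).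
Proof.
move=> oC cC /(dc_mappingP _ oC cC)[Hc [f fc Hf]] qlip Plip qP.
have [k [kc k0 Hk]] := nonneg_control oC cC fc Hf.
have [qc Pc] := (quad_lipschitz_continuous qlip, quad_lipschitz_continuous Plip).
have [[K K0 qK] [L L0 PL]] := (qlip, Plip).
(* The gap of |H| can be as low as - 2 |m' - H m|, while that of [2 * k] is at least 4 |m' - H m|;
   this leaves 2 |m' - H m| for [g]. Nonnegativity of [k] gives |H| <= g. *)
pose g x := `|H x| + 2 * k x.
apply/dc_mappingP => //; split.
  by move=> x xC; apply: (@continuous_comp _ _ _ H q); [exact: Hc|exact: qc].
(* [K] pays for the error q m' - q (H m), and [L] for the corresponding error in [P]. *)
exists (fun x => P (H x) + (K + L) * g x ^+ 2).
  have gc : {in C, continuous g}.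
    move=> x xC; apply: cvgD; first by apply: cvg_norm; exact: Hc.
    by apply: cvgM; [exact: cvg_cst|exact: kc].
  move=> x xC; apply: cvgD.
    by apply: (@continuous_comp _ _ _ H P); [exact: Hc|exact: Pc].
  by apply: cvgM; [exact: cvg_cst|apply: cvgM; exact: gc].
move=> x y Cx Cy.
have Cm := convex_set_mid cC Cx Cy.
rewrite (midgapD (P \o H)) midgapZ.
(* Here [m] stands for m' and [c] for H m in the notation of the overview. *)
set c := H (2^-1 *: (x + y)); set m := 2^-1 *: (H x + H y).
have HE : midgap H x y = 2 *: (m - c).
  by rewrite scalerBr scalerA divff// scale1r.
have qE : midgap (fun x => q (H x)) x y = midgap q (H x) (H y) + 2 *: (q m - q c).
  by rewrite /midgap -/c -/m scalerBr addrA subrK.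
have PE : midgap ((P \o H) : X -> R^o) x y = midgap P (H x) (H y) + 2 * (P m - P c).
  by rewrite !midgapE /= -/c -/m; lra.
have kD := Hk x y Cx Cy; rewrite HE normrZ normr_nat in kD.
have gD : 2 * `|m - c| * (`|m| + `|c|) <= midgap ((fun x => g x ^+ 2) : X -> R^o) x y.
  have mE : 2 * `|m| <= `|H x| + `|H y|.
    by rewrite /m normrZ ger0_norm ?invr_ge0// mulVKf// ler_normD.
  have [kx ky kz] := And3 (k0 _ Cx) (k0 _ Cy) (k0 _ Cm).
  apply: midgap_sqr_ge; rewrite ?mulr_ge0 ?addr_ge0//.
    move: kD; rewrite !midgapE /g -/c.
    have := ler_normD (c - m) m; rewrite subrK distrC; lra.
  by rewrite /g -/c; lra.
have := qK m c; have := PL m c; rewrite qE PE ler_norml => /andP[PLm _] qKm.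
apply: le_trans (ler_normD _ _) _; rewrite normrZ normr_nat.
have := qP (H x) (H y).
have := ler_wpM2l (addr_ge0 K0 L0) gD.
by move: PLm qKm; set T := `|m - c|; set U := `|m| + `|c|; nra.
Qed.

(** * Quadratic mappings: polarisation and continuity estimates *)

Lemma quadraticZ (R : realType) (W Z : lmodType R) (q : W -> Z) (a : R) (x : W) :
  quadratic q -> q (a *: x) = a ^+ 2 *: q x.
Proof. by move=> [s sE]; rewrite !sE linearZl_LR linearZr_LR scalerA. Qed.

(** The witness is the symmetrised form b(x, y) + b(y, x), twice the usual polar form. *)
Lemma quadratic_polar (R : realType) (W Z : lmodType R) (q : W -> Z) :
  quadratic q -> exists s : W -> W -> Z,
    [/\ forall (a c : R) x y, s (a *: x) (c *: y) = (a * c) *: s x y,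
        forall x y, q (x + y) = q x + q y + s x y
      & forall x y, q (x - y) = q x + q y - s x y].
Proof.
move=> [s sE]; exists (fun x y => s x y + s y x).
have sZ (a c : R) x y : s (a *: x) (c *: y) + s (c *: y) (a *: x) =
    (a * c) *: (s x y + s y x).
  by rewrite !linearZl_LR !linearZr_LR !scalerA scalerDr [c * a]mulrC.
have sD x y : q (x + y) = q x + q y + (s x y + s y x).
  by rewrite !sE linearDl !linearDr [RHS]addrACA [s y y + _]addrC.
split=> [//|//|x y].
have qN : q (- y) = q y.
  by rewrite -scaleN1r quadraticZ; [rewrite sqrrN expr1n scale1r|exists s].
have := sZ 1 (- 1) x y; rewrite sD qN scale1r mul1r !scaleN1r => ->.
by [].
Qed.

(** The parallelogram law. *)
Lemma quadratic_midgap (R : realType) (W Z : lmodType R) (q : W -> Z) (a b : W) :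
  quadratic q -> midgap q a b = 2^-1 *: q (a - b).
Proof.
move=> qq; have [s [_ sD sB]] := quadratic_polar qq.
rewrite /midgap (quadraticZ _ _ qq) sD sB scalerA.
have -> : 2 * 2^-1 ^+ 2 = 2^-1 :> R by field.
rewrite scalerDr opprD addrA scalerBr; congr (_ - _).
apply/eqP; rewrite subr_eq -scalerDl; apply/eqP.
by rewrite (_ : 2^-1 + 2^-1 = 1) ?scale1r//; field.
Qed.

(** Since 2 s(x, y) = q (x + y) - q (x - y), a bound on [q] near 0 bounds [s] near 0, and by
    homogeneity everywhere. The estimate follows from q u - q v = s(u - v, u + v) / 2. *)
Lemma quadratic_lipschitz (R : realType) (W Z : normedModType R) (q : W -> Z) :
  quadratic q -> continuous q -> quad_lipschitz q.
Proof.
move=> qq qc; have [s [sZ sD sB]] := quadratic_polar qq.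
have q0 : q 0 = 0 by rewrite -(scale0r 0) (quadraticZ _ _ qq) expr0n scale0r.
have : \forall w \near (0 : W), `|q w| <= 1.
  have /cvgr_dist_le/(_ 1 ltr01) := qc 0; rewrite q0; apply: filterS => w.
  by rewrite sub0r normrN.
move=> /nbhs_ballP[e /= e0 qe].
have qle w : `|w| < e -> `|q w| <= 1.
  by move=> we; apply: qe; rewrite -ball_normE/= sub0r normrN.
pose r := e / 4; have r0 : 0 < r by rewrite divr_gt0.
have sle x y : `|x| <= r -> `|y| <= r -> `|s x y| <= 1.
  move=> xr yr.
  have : `|2 *: s x y| <= 2.
    have -> : 2 *: s x y = q (x + y) - q (x - y).
      by rewrite sD sB opprB [RHS]addrC addrA subrK scaler_nat mulr2n.
    have xye : `|x + y| < e by have := ler_normD x y; rewrite /r in xr yr; lra.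
    have xye' : `|x - y| < e by have := ler_normB x y; rewrite /r in xr yr; lra.
    by have := ler_normB (q (x + y)) (q (x - y)); have := qle _ xye; have := qle _ xye'; lra.
  by rewrite normrZ normr_nat; lra.
clearbody r.
have sbound x y : `|s x y| <= r ^- 2 * (`|x| * `|y|).
  have s0 z : s 0 z = 0 /\ s z 0 = 0.
    have := (sZ 0 1 z z, sZ 1 0 z z).
    by rewrite !scale0r !scale1r mul0r mulr0 scale0r => -[].
  have [->|x0] := eqVneq x 0; first by rewrite (s0 y).1 !normr0 mul0r mulr0.
  have [->|y0] := eqVneq y 0; first by rewrite (s0 x).2 !normr0 !mulr0.
  have [nx ny] : 0 < `|x| /\ 0 < `|y| by rewrite !normr_gt0.
  have := sle ((r / `|x|) *: x) ((r / `|y|) *: y).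
  have nr z : z != 0 -> `|(r / `|z|) *: z| = r.
    by move=> z0; rewrite normrZ gtr0_norm ?divr_gt0 ?normr_gt0// divfK// normr_eq0.
  rewrite !nr// => /(_ (lexx _) (lexx _)).
  rewrite sZ normrZ gtr0_norm ?mulr_gt0 ?divr_gt0 ?invr_gt0//.
  rewrite -ler_pdivlMl ?mulr_gt0 ?divr_gt0 ?invr_gt0//.
  rewrite mulr1 => h; apply: le_trans h _; rewrite le_eqVlt; apply/orP; left; apply/eqP.
  by field; rewrite !gt_eqF.
exists (r ^- 2); first by rewrite invr_ge0 exprn_ge0// ltW.
move=> u v.
have -> : q u - q v = (2^-1 ^+ 2 * 2) *: s (u - v) (u + v).
  have e1 : (u - v) + (u + v) = 2 *: u by rewrite addrACA addNr addr0 scaler_nat mulr2n.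
  have e2 : (u - v) - (u + v) = (- 2) *: v.
    by rewrite opprD addrACA subrr add0r -opprD scaleNr scaler_nat mulr2n.
  have := sD (u - v) (u + v); have := sB (u - v) (u + v).
  rewrite e1 e2 !(quadraticZ _ _ qq) => h1 h2.
  apply: (@scalerI _ _ (2 ^+ 2)); first by rewrite expf_neq0.
  rewrite scalerBr h2 -[2 ^+ 2]sqrrN h1 opprB addrC addrA subrK sqrrN scalerA.
  by rewrite (_ : 2 ^+ 2 * _ = 2) ?scaler_nat ?mulr2n//; field.
rewrite normrZ ger0_norm; last by rewrite mulr_ge0// exprn_ge0// invr_ge0.
have := sbound (u - v) (u + v); have := ler_normD u v.
move=> h1 h2.
have h3 : r ^- 2 * (`|u - v| * `|u + v|) <= r ^- 2 * (`|u - v| * (`|u| + `|v|)).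
  by apply: ler_wpM2l; [rewrite invr_ge0 exprn_ge0// ltW|exact: ler_wpM2l].
have := normr_ge0 (s (u - v) (u + v)); lra.
Qed.

(** * Continuous coordinates on a finite-dimensional space *)

Lemma row_coord_le (R : realType) (n : nat) (v : 'rV[R]_n) (i : 'I_n) :
  `|v ord0 i| <= `|v|.
Proof.
rewrite [leRHS]/Num.Def.normr /= mx_normrE.
by apply/bigmax_geP; right => /=; exists (ord0, i).
Qed.

Lemma finite_dimensional_coord (R : realType) (Z : normedModType R) :
  finite_dimensional Z ->
  exists (n : nat) (e : 'I_n -> Z) (phi : 'I_n -> {linear Z -> R^o}),
    (forall i, continuous (phi i)) /\ forall z, z = \sum_i phi i z *: e i.
Proof.
move=> [n [[v2r v2r_lin [r2v v2rK r2vK]]]].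
have r2v_lin : linear r2v.
  by move=> a x y; apply: (can_inj v2rK); rewrite r2vK v2r_lin !r2vK.
have [f [g [fK gK]]] : exists (f : {linear Z -> 'rV[R]_n})
    (g : {linear 'rV[R]_n -> Z}), cancel f g /\ cancel g f.
  pose f : {linear Z -> 'rV[R]_n} :=
    HB.pack v2r (GRing.isLinear.Build R Z 'rV[R]_n _ v2r v2r_lin).
  pose g : {linear 'rV[R]_n -> Z} :=
    HB.pack r2v (GRing.isLinear.Build R 'rV[R]_n Z _ r2v r2v_lin).
  by exists f, g.
have gE v : g v = \sum_i v ord0 i *: g (delta_mx 0 i).
  by rewrite {1}[v]row_sum_delta linear_sum; apply: eq_bigr => i _; rewrite linearZ.
have gc : continuous g.
  apply/linear_bounded_continuous/bounded_funP => r.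
  exists (r * \sum_i `|g (delta_mx 0 i)|) => v vr.
  rewrite gE (le_trans (ler_norm_sum _ _ _))// mulr_sumr ler_sum// => i _.
  by rewrite normrZ ler_wpM2r// (le_trans (row_coord_le _ _)).
(* The continuous function |g v| has a positive minimum on the compact unit sphere, and its inverse
   bounds [f]. If the sphere is empty, then [f] vanishes. *)
have [M M0 fM] : exists2 M, 0 <= M & forall z, `|f z| <= M * `|z|.
  have [S0|S0] := pselect ([set v : 'rV[R]_n | `|v| = 1] !=set0); last first.
    exists 0 => // z; rewrite mul0r normr_le0; apply/negP => /negP fz0.
    apply: S0; exists (`|f z|^-1 *: f z) => /=.
    by rewrite normrZ normfV normr_id mulVf// normr_eq0.
  have cS : compact [set v : 'rV[R]_n | `|v| = 1].
    apply: bounded_closed_compact.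
      by exists 1; split => // x x1 v /= ->; exact: ltW.
    apply: (@closed_comp _ _ (fun v : 'rV[R]_n => `|v|) [set 1]).
      by move=> v _; exact: norm_continuous.
    exact: closed_eq.
  have [|c cS1 cmin] := compact_EVT_min S0 cS (f := fun v => `|g v|).
    apply: continuous_subspaceT => v.
    by apply: (@continuous_comp _ _ _ g (fun z : Z => `|z|)); [exact: gc|exact: norm_continuous].
  rewrite inE/= in cS1.
  have m0 : 0 < `|g c|.
    rewrite normr_gt0; apply/eqP => gc0.
    have : c = 0 by rewrite -[c]gK gc0 linear0.
    by move=> c0; move: cS1; rewrite c0 normr0 => /esym/eqP; rewrite oner_eq0.
  exists (`|g c|^-1); first by rewrite invr_ge0.
  move=> z; have [->|fz0] := eqVneq (f z) 0.
    by rewrite normr0 mulr_ge0// invr_ge0.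
  have nf : 0 < `|f z| by rewrite normr_gt0.
  have := cmin (`|f z|^-1 *: f z); rewrite inE/= normrZ normfV normr_id mulVf ?gt_eqF//.
  move=> /(_ erefl); rewrite linearZ normrZ normfV normr_id.
  by rewrite fK ler_pdivlMl// ler_pdivlMl// mulrC.
have phi_lin i : linear (fun z => f z ord0 i : R^o).
  by move=> a x y; rewrite linearP !mxE.
pose phi i : {linear Z -> R^o} :=
  HB.pack (fun z => f z ord0 i : R^o) (GRing.isLinear.Build R Z R^o _ _ (phi_lin i)).
exists n, (fun i => g (delta_mx 0 i)), phi; split.
  move=> i; apply/linear_bounded_continuous/bounded_funP => r.
  exists (M * r) => z zr; apply: le_trans (row_coord_le (f z) i) _.
  by rewrite (le_trans (fM z))// ler_wpM2l.
by move=> z; rewrite -[LHS]fK [LHS]gE.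
Qed.

(** * Norms with modulus of convexity of power type 2 *)

Lemma power_type2_midgap (R : realType) (X : lmodType R) (N : X -> R) :
  is_norm N -> convexity_power_type2 N ->
  exists2 c : R, 0 < c & forall x y,
    c * N (x - y) ^+ 2 <= midgap ((fun x => N x ^+ 2) : X -> R^o) x y.
Proof.
move=> [N0 N0_eq0 NZ ND] [a a0 aN].
have NN x : N (- x) = N x by rewrite -scaleN1r NZ normrN1 mul1r.
have N00 : N 0 = 0 by rewrite -(scale0r 0) NZ normr0 mul0r.
(* The gap will be at least (N x - N y)^2 / 2 + 2 a (N y * e)^2, and N (x - y)^2 at most 2 ((N x - N
   y)^2 + (N y * e)^2): the radial terms need c <= 1/4, the angular ones c <= a. *)
pose c := Num.min 4^-1 a.
have [c0 c4 ca] : [/\ 0 < c, c <= 4^-1 & c <= a].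
  by rewrite /c lt_min a0 invr_gt0 ltr0n !ge_min !lexx orbT.
exists c => // x y; wlog yx : x y / N y <= N x.
  have [yx|/ltW xy] := leP (N y) (N x); first exact.
  by move=> /(_ _ _ xy); rewrite -NN opprB !midgapE [y + x]addrC [N y ^+ 2 + _]addrC.
rewrite midgapE; set u := 2^-1 *: (x + y).
have [y0|y0] := eqVneq (N y) 0.
  have {}y0 := N0_eq0 _ y0.
  rewrite /u y0 subr0 addr0 N00 NZ ger0_norm ?invr_ge0//.
  have := sqr_ge0 (N x); nra.
have t0 : 0 < N y by rewrite lt_neqAle eq_sym y0 N0.
have r0 : 0 < N x := lt_le_trans t0 yx.
pose x' := (N x)^-1 *: x; pose y' := (N y)^-1 *: y.
have x'1 : N x' = 1 by rewrite NZ gtr0_norm ?invr_gt0// mulVf// gt_eqF.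
have y'1 : N y' = 1 by rewrite NZ gtr0_norm ?invr_gt0// mulVf.
have xE : x = N x *: x' by rewrite scalerA divff ?scale1r// gt_eqF.
have yE : y = N y *: y' by rewrite scalerA divff ?scale1r.
pose e := N (x' - y').
have mid' : N (2^-1 *: (x' + y')) <= 1 - a * e ^+ 2.
  have e2 : e <= 2 by have := ND x' (- y'); rewrite NN x'1 y'1.
  (* The modulus is controlled only for positive arguments; at e = 0 the triangle inequality
     suffices. *)
  have [e0|e0] := eqVneq e 0.
    rewrite e0 NZ ger0_norm ?invr_ge0//; have := ND x' y'; rewrite x'1 y'1; lra.
  have e_gt0 : 0 < e by rewrite lt_neqAle eq_sym e0 N0.
  have e02 : 0 < e <= 2 by rewrite e_gt0.
  have : ((a * e ^+ 2)%:E <= (1 - N (2^-1 *: (x' + y')))%:E)%E.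
    apply: le_trans (aN e e02) _; apply: ereal_inf_lbound.
    by exists (x', y') => //=; rewrite x'1 y'1.
  by rewrite lee_fin; lra.
(* The excess length of [x] is split off, so that the modulus applies to the midpoint of the two
   unit vectors. *)
have uE : u = ((N x - N y) / 2) *: x' + N y *: (2^-1 *: (x' + y')).
  rewrite /u {1}xE {1}yE !scalerDr !scalerA addrA -scalerDl.
  by congr (_ *: _ + _ *: _); lra.
have Nu : N u <= (N x + N y) / 2 - N y * (a * e ^+ 2).
  rewrite uE; apply: le_trans (ND _ _) _.
  rewrite NZ x'1 NZ (gtr0_norm t0) ger0_norm; last by lra.
  have := ler_wpM2l (ltW t0) mid'; lra.
have dE : x - y = (N x - N y) *: x' + N y *: (x' - y').
  by rewrite {1}xE {1}yE scalerBl scalerBr addrA subrK.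
have Nd : N (x - y) <= (N x - N y) + N y * e.
  rewrite dE; apply: le_trans (ND _ _) _.
  by rewrite NZ x'1 mulr1 NZ (gtr0_norm t0) ger0_norm// subr_ge0.
have q0 : 0 <= N y * (a * e ^+ 2).
  by apply: mulr_ge0; [exact: N0|apply: mulr_ge0; [exact: ltW|exact: sqr_ge0]].
have Nu2 : N u ^+ 2 <= (N x + N y) / 2 * ((N x + N y) / 2 - N y * (a * e ^+ 2)).
  rewrite expr2; apply: ler_pM; [exact: N0|exact: N0| |exact: Nu].
  by apply: le_trans Nu _; rewrite gerBl.
have sq2 : N (x - y) ^+ 2 <= 2 * ((N x - N y) ^+ 2 + (N y * e) ^+ 2).
  have : N (x - y) ^+ 2 <= ((N x - N y) + N y * e) ^+ 2.
    by rewrite lerXn2r ?nnegrE// (le_trans (N0 _) Nd).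
  have := sqr_ge0 (N x - N y - N y * e); nra.
have ye : N y * (N y * (a * e ^+ 2)) <= (N x + N y) / 2 * (N y * (a * e ^+ 2)).
  by apply: ler_wpM2r; [exact: q0|lra].
have h1 := ler_wpM2l (ltW c0) sq2.
have h2 := ler_wpM2r (sqr_ge0 (N x - N y)) c4.
have h3 := ler_wpM2r (sqr_ge0 (N y * e)) ca.
nra.
Qed.

Lemma power_type2_control (R : realType) (Y : normedModType R) :
  admits_power_type2_norm Y -> exists P : Y -> R^o,
    quad_lipschitz P /\ forall a b, `|a - b| ^+ 2 <= midgap P a b.
Proof.
move=> [N [Nnorm [k [d [k0 d0 kd]]]] Npt].
have [c c0 cN] := power_type2_midgap Nnorm Npt.
have [N0 _ NZ ND] := Nnorm.
have [kN Nd] : (forall x, k * `|x| <= N x) /\ (forall x, N x <= d * `|x|).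
  by split=> x; have /andP[] := kd x.
(* Since N >= k |.|, this factor turns c N (a - b)^2 into a bound for |a - b|^2. *)
pose A := (c * k ^+ 2)^-1.
have A0 : 0 < A by rewrite invr_gt0 mulr_gt0// exprn_gt0.
exists (fun x => A * N x ^+ 2); split; last first.
  move=> a b; rewrite midgapZ mulrC ler_pdivlMr ?mulr_gt0 ?exprn_gt0//.
  apply: le_trans (cN a b).
  rewrite mulrCA; apply: ler_wpM2l; first exact: ltW.
  rewrite mulrC -exprMn lerXn2r ?nnegrE//.
  by rewrite mulr_ge0// ltW.
exists (A * d ^+ 2); first by rewrite mulr_ge0 ?sqr_ge0// ltW.
move=> u v; rewrite -mulrBr normrM (gtr0_norm A0) -mulrA.
apply: ler_wpM2l; first exact: ltW.
have NB : `|N u - N v| <= N (u - v).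
  have NN x : N (- x) = N x by rewrite -scaleN1r NZ normrN1 mul1r.
  have := ND (u - v) v; have := ND (v - u) u.
  by rewrite !subrK -(NN (v - u)) opprB ler_norml; lra.
rewrite subr_sqr normrM [`|N u + N v|]ger0_norm ?addr_ge0//.
rewrite expr2 mulrACA ler_pM ?addr_ge0//.
  exact: le_trans NB (Nd _).
by rewrite mulrDr lerD.
Qed.

(** * Controls for the bilinear mapping in the two cases *)

Lemma quad_lipschitzD (R : realType) (W Z : normedModType R) (p q : W -> Z) :
  quad_lipschitz p -> quad_lipschitz q -> quad_lipschitz (fun w => p w + q w).
Proof.
move=> [K K0 pK] [L L0 qL]; exists (K + L); first exact: addr_ge0.
move=> u v; rewrite opprD addrACA mulrDl.
exact: le_trans (ler_normD _ _) (lerD (pK u v) (qL u v)).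
Qed.

Lemma quad_lipschitzZ (R : realType) (W : normedModType R) (c : R) (q : W -> R^o) :
  quad_lipschitz q -> quad_lipschitz ((fun w => c * q w) : W -> R^o).
Proof.
move=> [K K0 qK]; exists (`|c| * K); first exact: mulr_ge0.
by move=> u v; rewrite -mulrBr normrM -mulrA ler_wpM2l// qK.
Qed.

Lemma quad_lipschitz_sum (R : realType) (W Z : normedModType R) (n : nat)
    (q : 'I_n -> W -> Z) :
  (forall i, quad_lipschitz (q i)) -> quad_lipschitz (fun w => \sum_i q i w).
Proof.
move=> qlip; elim: n q qlip => [|n IHn] q qlip.
  by exists 0 => // u v; rewrite !big_ord0 subrr normr0 mul0r.
under eq_fun do rewrite big_ord_recr/=.
by apply: quad_lipschitzD => //; exact: IHn.
Qed.

Lemma quad_lipschitz_comp (R : realType) (U W Z : normedModType R) (g : U -> W)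
    (q : W -> Z) :
  (forall u, `|g u| <= `|u|) -> (forall u v, `|g u - g v| <= `|u - v|) ->
  quad_lipschitz q -> quad_lipschitz (fun u => q (g u)).
Proof.
move=> g1 g2 [K K0 qK]; exists K => // u v.
apply: le_trans (qK _ _) _; apply: ler_wpM2l => //.
by apply: ler_pM; [exact: normr_ge0|exact: addr_ge0|exact: g2|exact: lerD].
Qed.

Lemma midgap_sum (R : realType) (X W : lmodType R) (n : nat)
    (F : 'I_n -> X -> W) (x y : X) :
  midgap (fun x => \sum_i F i x) x y = \sum_i midgap (F i) x y.
Proof. by rewrite /midgap sumrB big_split/= scaler_sumr. Qed.

Lemma quadratic_bilinear (R : realType) (Y V Z : lmodType R)
    (B : {bilinear Y -> V -> Z}) :
  quadratic (fun p : Y * V => B p.1 p.2).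
Proof.
pose s (p q : Y * V) := B p.1 q.2.
have slin : bilinear_for *:%R *:%R s.
  split=> p a u v; rewrite /s/=; first by rewrite linearDl linearZl_LR.
  by rewrite linearDr linearZr_LR.
pose sB : {bilinear (Y * V)%type -> (Y * V)%type -> Z} :=
  HB.pack s (bilinear_isBilinear.Build R _ _ _ _ _ s slin).
by exists sB.
Qed.

Lemma quadratic_linear (R : realType) (W Z Z' : lmodType R)
    (q : W -> Z) (phi : {linear Z -> Z'}) :
  quadratic q -> quadratic (fun w => phi (q w)).
Proof.
move=> [s sE]; pose t (u v : W) := phi (s u v).
have tlin : bilinear_for *:%R *:%R t.
  split=> p a u v; rewrite /t/=.
    by rewrite linearDl linearZl_LR linearD linearZ.
  by rewrite linearDr linearZr_LR linearD linearZ.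
pose tB : {bilinear W -> W -> Z'} :=
  HB.pack t (bilinear_isBilinear.Build R _ _ _ _ _ t tlin).
by exists tB => w; rewrite sE.
Qed.

(** The gap of [B] is B (a - b) / 2, with norm at most k t r / 2 for the component norms t and r of
    a - b. Now t r <= (t^2 + r^2) / 2, and each square is dominated by the gap of the control on its
    factor. *)
Lemma bilinear_control_power_type2 (R : realType) (Y V Z : normedModType R)
    (B : {bilinear Y -> V -> Z}) :
  continuous (fun p : Y * V => B p.1 p.2) ->
  admits_power_type2_norm Y -> admits_power_type2_norm V ->
  exists P : (Y * V)%type -> R^o, quad_lipschitz P /\
    forall a b, `|midgap (fun p : Y * V => B p.1 p.2) a b| <= midgap P a b.
Proof.
move=> Bc /power_type2_control[P [Plip Ple]] /power_type2_control[S [Slip Sle]].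
have [k k0 Bk] := bilinear_schwarz Bc.
exists (fun p => k * (P p.1 + S p.2)); split.
  apply: quad_lipschitzZ; apply: quad_lipschitzD.
    apply: (quad_lipschitz_comp (g := fst)) => // [u|u v];
      by rewrite prod_normE le_max lexx.
  apply: (quad_lipschitz_comp (g := snd)) => // [u|u v];
    by rewrite prod_normE le_max lexx orbT.
move=> a b; rewrite (quadratic_midgap _ _ (quadratic_bilinear B)) /=.
rewrite normrZ ger0_norm ?invr_ge0//.
have -> : midgap ((fun p : Y * V => k * (P p.1 + S p.2)) : _ -> R^o) a b =
    k * (midgap P a.1 b.1 + midgap S a.2 b.2).
  by rewrite !midgapE /=; ring.
have /= := Bk (a.1 - b.1) (a.2 - b.2).
have := ler_wpM2l (ltW k0) (Ple a.1 b.1).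
have := ler_wpM2l (ltW k0) (Sle a.2 b.2).
have := ler_wpM2l (ltW k0) (sqr_ge0 (`|a.1 - b.1| - `|a.2 - b.2|)).
set t := `|a.1 - b.1|; set r := `|a.2 - b.2|.
nra.
Qed.

(** Property (D) splits each coordinate of [q] as Q1 - Q2 with nonnegative forms, so its absolute
    value is at most Q1 + Q2; the weights |e i| reassemble the norm in [Z]. *)
Lemma quadratic_control_property_D (R : realType) (W Z : normedModType R)
    (q : W -> Z) :
  quadratic q -> continuous q -> finite_dimensional Z -> property_D W ->
  exists P : W -> R^o, quad_lipschitz P /\
    forall a b, `|midgap q a b| <= midgap P a b.
Proof.
move=> qq qc /finite_dimensional_coord[n [e [phi [phic phiE]]]] WD.
have {WD} /choice[Q Qi] : forall i, exists Q : (W -> R^o) * (W -> R^o),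
    [/\ quadratic Q.1 /\ quadratic Q.2, continuous Q.1 /\ continuous Q.2,
      forall w, 0 <= Q.1 w, forall w, 0 <= Q.2 w
      & forall w, phi i (q w) = Q.1 w - Q.2 w].
  move=> i; have [||Q1 [Q2 h]] := WD (fun w => phi i (q w)).
  - exact: quadratic_linear.
  - by move=> w; apply: (@continuous_comp _ _ _ q (phi i)); [exact: qc|exact: phic].
  by exists (Q1, Q2).
exists (fun w => \sum_i `|e i| * ((Q i).1 w + (Q i).2 w)); split.
  apply: (@quad_lipschitz_sum R W R^o) => i.
  have [[q1 q2] [c1 c2] _ _ _] := Qi i.
  by apply: quad_lipschitzZ; apply: quad_lipschitzD; exact: quadratic_lipschitz.
move=> a b.
rewrite (@midgap_sum R W R^o n (fun i w => `|e i| * ((Q i).1 w + (Q i).2 w))).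
rewrite quadratic_midgap// [q _]phiE scaler_sumr.
apply: le_trans (ler_norm_sum _ _ _) _; apply: ler_sum => i _.
have [[q1 q2] _ Q1 Q2 QE] := Qi i.
rewrite midgapZ (midgapD (Q i).1) !quadratic_midgap// QE.
rewrite normrZ normrZ ger0_norm ?invr_ge0// mulrCA [in leLHS]mulrC -mulrA.
rewrite -scalerDr mulrCA; apply: ler_wpM2l; first exact: normr_ge0.
apply: ler_wpM2l; first by rewrite invr_ge0.
by apply: le_trans (ler_normB _ _) _; rewrite !ger0_norm.
Qed.

Theorem corollary3p9 (R : realType) (X Y V Z : normedModType R)
    (C : set X) (F : X -> Y) (G : X -> V) (B : {bilinear Y -> V -> Z})
    (C_open : open C) (C_convex : convex_set C)
    (F_dc : dc_mapping C F) (G_dc : dc_mapping C G)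
    (B_continuous : continuous (fun p : Y * V => B p.1 p.2))
    (hyp : (admits_power_type2_norm Y /\ admits_power_type2_norm V)
           \/ (finite_dimensional Z /\ property_D (Y * V)%type)) :
  dc_mapping C (fun x => B (F x) (G x)).
Proof.
have Bq := quadratic_bilinear B.
have [P [Plip BP]] : exists P : (Y * V)%type -> R^o, quad_lipschitz P /\
    forall a b, `|midgap (fun p : Y * V => B p.1 p.2) a b| <= midgap P a b.
  case: hyp => [[Y2 V2]|[Zfin YVD]]; first exact: bilinear_control_power_type2.
  exact: quadratic_control_property_D.
have FG_dc := dc_mapping_pair C_open C_convex F_dc G_dc.
exact: (dc_mapping_comp C_open C_convex FG_dc (quadratic_lipschitz Bq B_continuous)
  Plip BP).
Qed.
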